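(* Let $0<\beta<1$ and $a_k=\lfloor k^\beta\rfloor$ for $k=1,2,\dots$. Then the $\mathbf{a}$-walk is almost surely transient.
   Context: Let $X_1,X_2,\dots$ be i.i.d. with $P(X_i=1)=P(X_i=-1)=\frac12$. For a non-random sequence $\mathbf{a}=(a_1,a_2,\dots)$ of positive numbers, the $\mathbf{a}$-walk is $S(n)=\sum_{k=1}^n a_kX_k$, $S(0)=0$. For $C\ge 0$, the walk is $C$-recurrent if $\{|S(n)|\le C\}$ occurs for infinitely many $n$. The walk is transient if it is not $C$-recurrent for any $C\ge 0$; ''almost surely transient'' means that with probability one, for every $C\ge0$, $|S(n)|\le C$ holds for only finitely many $n$. *)

(* Defs.v *)
From HB Require Import structures.
From mathcomp Require Import all_boot all_order all_algebra.
From mathcomp Require Import finmap.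
From mathcomp Require Import all_classical all_reals all_analysis.
Set Implicit Arguments.
Unset Strict Implicit.
Unset Printing Implicit Defensive.
Import Order.TTheory GRing.Theory Num.Theory.
Import numFieldNormedType.Exports.
Local Open Scope classical_set_scope.
Local Open Scope ring_scope.

(* Mutual independence: the product rule over every finite subfamily and all
   choices of Borel sets. *)
Definition independent_RVs d (T : measurableType d) (R : realType)
    (P : probability T R) (I : choiceType) (X : I -> {RV P >-> R}) : Prop :=
  forall (F : {fset I}) (B : I -> set R),
    (forall i, measurable (B i)) ->
    P (\bigcap_(i in [set` F]) (X i @^-1` B i)) =
    (\prod_(i <- F) P (X i @^-1` B i))%E.

Definition rademacher d (T : measurableType d) (R : realType)
    (P : probability T R) (X : {RV P >-> R}) : Prop :=
  P (X @^-1` [set 1]) = (2^-1)%:E /\ P (X @^-1` [set -1]) = (2^-1)%:E.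

(* Sequences are indexed from 0: [X k] and [a k] stand for X_(k+1) and a_(k+1),
   so [walk a X n] is S(n) = a_1 X_1 + ... + a_n X_n. *)
Definition walk d (T : measurableType d) (R : realType)
    (P : probability T R) (a : nat -> R) (X : nat -> {RV P >-> R})
    (n : nat) (w : T) : R :=
  \sum_(k < n) a k * X k w.

(* The next two notions are about a single trajectory [s] of the walk. *)
Definition recurrent_at (R : realType) (C : R) (s : nat -> R) : Prop :=
  infinite_set [set n | `|s n| <= C].

Definition transient (R : realType) (s : nat -> R) : Prop :=
  forall C : R, 0 <= C -> ~ recurrent_at C s.

Definition almost_surely_transient d (T : measurableType d) (R : realType)
    (P : probability T R) (a : nat -> R) (X : nat -> {RV P >-> R}) : Prop :=
  {ae P, forall w, transient (fun n => walk a X n w)}.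

(* [floor_pow beta k] is a_(k+1) for a_k = floor (k ^ beta). *)
Definition floor_pow (R : realType) (beta : R) (k : nat) : R :=
  (Num.floor (k.+1%:R `^ beta))%:~R.

(* Main.v *)
Require Import Defs.
From HB Require Import structures.
From mathcomp Require Import all_boot all_order all_algebra.
From mathcomp Require Import finmap.
From mathcomp Require Import all_classical all_reals all_analysis.
From mathcomp Require Import ring lra zify.
Set Implicit Arguments.
Unset Strict Implicit.
Unset Printing Implicit Defensive.
Import Order.TTheory GRing.Theory Num.Theory.
Import numFieldNormedType.Exports.
Local Open Scope ring_scope.

(** Group the steps into runs: the speed [a_k] equals [m] on a run of length
    [L_m], of order [m ^ (1 / beta - 1)]. During that run the walk stays in a
    fixed class modulo [m], so to come within distance [C] of the origin it must
    start the run within distance [C] of some [- m v], with [v] in the range of a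
    simple random walk of length [L_m]; that range has about [sqrt L_m] points
    ([sign_mean_reach]). Hence the probability of visiting the window
    during the run is at most [sqrt L_m] times the largest mass [Q_m] that
    the walk at the start of the run puts on a window
    ([sign_mean_visits_window]).

    The mass [Q_m] is bounded through the characteristic function, a product of
    cosines. Esseen's inequality ([esseen_concentration]) reduces the matter to
    the decay of [prod_k |cos (phi a_k)|], hence to lower bounds for
    [sum_k sin (phi a_k) ^ 2]. With [2 ^ i] of order [m], each of the speeds in
    [2 ^ (i + 1), 2 ^ (i + 2)) is kept for at least a constant times [L_m]
    steps, and comparing the speeds [j] and [j + d] shows that the sum is at
    least of order [L_m 2 ^ i sin (d phi) ^ 2] for each [d <= 2 ^ i]
    ([sum_sin_sqr_ge_shift]). Doubling [d] repeatedly makes [sin (d phi)]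
    either macroscopic or larger than [sin phi] by a factor [sqrt 3 ^ i]
    ([sin_doubling_ge]). This gives [Q_m] of order [(L_m 6 ^ i) ^ (-1/2)]
    ([block_concentration]); the true order is [(L_m 8 ^ i) ^ (-1/2)], but the
    weaker bound is enough.

    The factor [sqrt L_m] cancels, and a run of speed [m] in
    [2 ^ (i + 2), 2 ^ (i + 3)) visits the window with probability of order
    [6 ^ (-i/2)]. There are [2 ^ (i + 2)] such runs, so the probability that some
    run of this dyadic group visits the window is of order [(2 / 3) ^ (i/2)],
    which is summable, and the Borel-Cantelli lemma concludes
    ([ae_transient_runs]). Counting single times instead would fail when
    [beta <= 1/2], since then the expected number of visits is infinite: a
    returning walk returns many times within the same run. *)

(** * Averages over sequences of signs *)

Section SignAverages.
Context {R : realType}.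
Implicit Types (n k : nat) (F G : seq bool -> R) (a : nat -> R) (s t : seq bool).

Definition sgn (b : bool) : R := if b then 1 else -1.

(** The mean of [F] over the [2 ^ n] sequences of [n] signs. The recursion on the
    first sign makes the independence of successive pieces of a sequence
    ([sign_mean_cat]) hold by definition. *)
Fixpoint sign_mean n F : R :=
  if n is k.+1 then
    (sign_mean k (fun s => F (true :: s)) + sign_mean k (fun s => F (false :: s))) / 2
  else F [::].

Fixpoint signed_sum a s : R :=
  if s is b :: t then sgn b * a 0 + signed_sum (fun i => a i.+1) t else 0.

Lemma le_sign_mean n F G :
  (forall s, size s = n -> F s <= G s) -> sign_mean n F <= sign_mean n G.
Proof.
elim: n F G => [|n IH] F G FG /=; first exact: FG.
by rewrite ler_pM2r ?invr_gt0//; apply: lerD; apply: IH => s sn; apply: FG;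
  rewrite /= sn.
Qed.

Lemma eq_sign_mean n F G :
  (forall s, size s = n -> F s = G s) -> sign_mean n F = sign_mean n G.
Proof.
by move=> FG; apply/le_anti/andP; split; apply: le_sign_mean => s /FG ->.
Qed.

Lemma sign_mean_cst n c : sign_mean n (fun=> c) = c.
Proof. by elim: n => //= n ->; lra. Qed.

Lemma sign_meanD n F G :
  sign_mean n (fun s => F s + G s) = sign_mean n F + sign_mean n G.
Proof. by elim: n F G => //= n IH F G; rewrite !IH; lra. Qed.

Lemma sign_meanZ n c F : sign_mean n (fun s => c * F s) = c * sign_mean n F.
Proof. by elim: n F => //= n IH F; rewrite !IH; lra. Qed.

Lemma sign_mean_sum n (I : Type) (r : seq I) (F : I -> seq bool -> R) :
  sign_mean n (fun s => \sum_(i <- r) F i s) = \sum_(i <- r) sign_mean n (F i).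
Proof.
elim: r => [|i r IH].
  rewrite big_nil -[RHS](sign_mean_cst n).
  by apply: eq_sign_mean => s _; rewrite big_nil.
rewrite big_cons -IH -sign_meanD.
by apply: eq_sign_mean => s _; rewrite big_cons.
Qed.

Lemma sign_mean_cat n k F :
  sign_mean (n + k) F = sign_mean n (fun s => sign_mean k (fun t => F (s ++ t))).
Proof. by elim: n F => //= n IH F; rewrite !IH. Qed.

Lemma exchange_sign_mean n k (F : seq bool -> seq bool -> R) :
  sign_mean n (fun s => sign_mean k (F s)) =
  sign_mean k (fun t => sign_mean n (fun s => F s t)).
Proof.
elim: n F => //= n IH F; rewrite !IH -sign_meanD mulrC -sign_meanZ.
by apply: eq_sign_mean => t _; rewrite mulrC.
Qed.

Lemma signed_sum_cat a s t :
  signed_sum a (s ++ t) = signed_sum a s + signed_sum (fun i => a (size s + i)%N) t.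
Proof.
by elim: s a => [|b s IH] a /=; rewrite ?add0r// IH addrA.
Qed.

Lemma eq_signed_sum a a' s :
  (forall i, (i < size s)%N -> a i = a' i) -> signed_sum a s = signed_sum a' s.
Proof.
elim: s a a' => //= b s IH a a' aa'; congr (_ + _); first by rewrite aa'.
by apply: IH => i si; apply: aa'.
Qed.

Lemma signed_sum_nth a s :
  signed_sum a s = \sum_(k < size s) a k * sgn (nth false s k).
Proof.
elim: s a => [|b s IH] a /=; first by rewrite big_ord0.
by rewrite big_ord_recl /= IH mulrC.
Qed.

(** The characteristic function of a sum of independent signs is a product of
    cosines. It is real by symmetry, which is why a shift by [x] only contributes
    the factor [cos (y x)]. *)
Lemma sign_mean_cos n a (y x : R) :
  sign_mean n (fun s => cos (y * (signed_sum a s - x))) =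
  cos (y * x) * \prod_(k < n) cos (y * a k).
Proof.
elim: n a x => [|n IH] a x /=.
  by rewrite big_ord0 mulr1 sub0r mulrN cosN.
under [in X in X / _]eq_sign_mean => s _.
  rewrite (_ : _ - x = signed_sum (fun i => a i.+1) s - (x - a 0)); last first.
    by rewrite /sgn; lra.
  over.
under [X in _ + X]eq_sign_mean => s _.
  rewrite (_ : _ - x = signed_sum (fun i => a i.+1) s - (x + a 0)); last first.
    by rewrite /sgn; lra.
  over.
rewrite !IH big_ord_recl /= (mulrBr y x) (mulrDr y x) cosB (cosD (y * x)).
set p := \prod_(_ < _) _; lra.
Qed.

End SignAverages.

(** * Concentration from the decay of the characteristic function *)

Section Trigonometry.
Context {R : realType}.
Implicit Types x y : R.

Lemma sin_mean_value x : 0 <= x -> exists2 c, 0 <= c <= x & sin x = cos c * x.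
Proof.
move=> x0.
have dsin z : z \in `]0, x[ -> is_derive z 1 (@sin R) (cos z).
  by move=> _; exact: is_derive_sin.
have [|c] := MVT_segment x0 dsin.
  by apply: continuous_subspaceT; exact: continuous_sin.
by rewrite in_itv /= sin0 !subr0; exists c.
Qed.

Lemma ler_norm_sin x : `|sin x| <= `|x|.
Proof.
have pos y : 0 <= y -> `|sin y| <= y.
  move=> y0; have [c _ ->] := sin_mean_value y0.
  by rewrite normrM (ger0_norm y0) ler_piMl// cos_max.
have [x0|x0] := leP 0 x; first by rewrite (ger0_norm x0) pos.
by rewrite -normrN -sinN (ltr0_norm x0) pos// oppr_ge0 ltW.
Qed.

Lemma cos_ge_half x : `|x| <= 1 -> 2^-1 <= cos x.
Proof.
move=> x1.
have -> : x = (x / 2) *+ 2 by rewrite -mulr_natr divfK.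
rewrite cos_mulr2n cos2sin2.
have s2 : sin (x / 2) ^+ 2 <= 4^-1.
  rewrite -real_normK ?num_real// (_ : 4^-1 = 2^-1 ^+ 2); last by field.
  rewrite ler_pXn2r ?nnegrE ?invr_ge0// (le_trans (ler_norm_sin _))//.
  by rewrite normrM (ger0_norm (_ : 0 <= 2^-1))// ler_piMl.
by lra.
Qed.

Lemma sin_ge_half x : 0 <= x <= 1 -> x / 2 <= sin x.
Proof.
move=> /andP[x0 x1]; have [c /andP[c0 cx] ->] := sin_mean_value x0.
by rewrite mulrC ler_wpM2r// cos_ge_half// ger0_norm// (le_trans cx).
Qed.

(** From [cos ^ 2 = 1 - sin ^ 2 <= exp (- sin ^ 2)]. *)
Lemma ler_norm_cos_expR x : `|cos x| <= expR (- (sin x ^+ 2 / 2)).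
Proof.
rewrite -(ler_pXn2r (_ : (0 < 2)%N)) ?nnegrE ?expR_ge0//.
rewrite real_normK ?num_real// cos2sin2 -expRM_natr mulNr divfK//.
exact: expR_ge1Dx.
Qed.

End Trigonometry.

Section Concentration.
Context {R : realType}.
Implicit Types (n N : nat) (a : nat -> R) (s : seq bool) (C x y : R).

(** The squared modulus of the sum of [exp (i r y)] over [r < N]; written as a
    double sum of cosines it is linear in the characteristic function. *)
Lemma dirichlet_sqr N y :
  (\sum_(r < N) cos (r%:R * y)) ^+ 2 + (\sum_(r < N) sin (r%:R * y)) ^+ 2 =
  \sum_(r < N) \sum_(q < N) cos ((r%:R - q%:R) * y).
Proof.
rewrite !expr2 !big_distrlr /= -big_split; apply: eq_bigr => r _ /=.
by rewrite -big_split; apply: eq_bigr => q _ /=; rewrite mulrBl cosB.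
Qed.

Lemma dirichlet_sqr_ge N y : `|y| * N%:R <= 1 ->
  N%:R ^+ 2 / 4 <= \sum_(r < N) \sum_(q < N) cos ((r%:R - q%:R) * y).
Proof.
move=> yN; rewrite -dirichlet_sqr -[leLHS]addr0 lerD ?sqr_ge0//.
have -> : N%:R ^+ 2 / 4 = (N%:R / 2) ^+ 2 :> R by field.
rewrite ler_pXn2r ?nnegrE ?sumr_ge0 ?divr_ge0// => [|r _]; last first.
  rewrite (le_trans (_ : 0 <= 2^-1))// cos_ge_half// normrM ger0_norm// mulrC.
  by rewrite (le_trans _ yN)// ler_wpM2l// ler_nat ltnW.
rewrite (_ : N%:R / 2 = \sum_(r < N) 2^-1); last first.
  by rewrite sumr_const card_ord mulr_natl.
apply: ler_sum => r _; rewrite cos_ge_half// normrM ger0_norm// mulrC.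
by rewrite (le_trans _ yN)// ler_wpM2l// ler_nat ltnW.
Qed.

(** Esseen's inequality in discrete form: the squared Dirichlet kernel is
    nonnegative everywhere and at least a quarter of its maximum near the origin,
    so it dominates the indicator of the window. *)
Lemma esseen_concentration n a N C x : (0 < N)%N -> 0 < C ->
  sign_mean n (fun s => (`|signed_sum a s - x| <= C)%R%:R) <=
  4 / N%:R ^+ 2 * \sum_(r < N) \sum_(q < N)
    `|\prod_(k < n) cos ((r%:R - q%:R) / (C * N%:R) * a k)|.
Proof.
move=> N0 C0; have N0' : 0 < N%:R :> R by rewrite ltr0n.
have CN : 0 < C * N%:R by rewrite mulr_gt0.
set K := fun z : R => \sum_(r < N) \sum_(q < N) cos ((r%:R - q%:R) * (z / (C * N%:R))).
have H s : (`|signed_sum a s - x| <= C)%R%:R <= 4 / N%:R ^+ 2 * K (signed_sum a s - x).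
  case: (boolP (`|_| <= C)) => [zC|_] /=.
    rewrite mulrAC ler_pdivlMr ?exprn_gt0// mul1r mulrC -ler_pdivrMr//.
    apply: dirichlet_sqr_ge; rewrite normrM normfV (gtr0_norm CN).
    rewrite mulrAC ler_pdivrMr// mul1r ler_wpM2r//.
  by rewrite mulr_ge0 ?divr_ge0 ?exprn_ge0// /K -dirichlet_sqr addr_ge0 ?sqr_ge0.
apply: le_trans (le_sign_mean (fun s _ => H s)) _.
rewrite sign_meanZ ler_wpM2l ?divr_ge0 ?exprn_ge0//.
rewrite /K sign_mean_sum; apply: ler_sum => r _.
rewrite sign_mean_sum; apply: ler_sum => q _.
set y := (_ - _) / _.
rewrite (@eq_sign_mean _ _ _ (fun s => cos (y * (signed_sum a s - x)))) => [|s _].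
  rewrite sign_mean_cos (le_trans (ler_norm _))// normrM.
  by rewrite ler_piMl// cos_max.
by congr cos; rewrite mulrA mulrAC.
Qed.

Lemma sum_inv_sqr_le N : \sum_(h < N) (1 + h%:R ^+ 2)^-1 <= 3 :> R.
Proof.
case: N => [|N]; first by rewrite big_ord0.
(* Compare with the telescoping series of [2 / (h (h + 1))]. *)
suff : \sum_(h < N.+1) (1 + h%:R ^+ 2)^-1 <= 3 - 2 / N.+1%:R :> R.
  by move/le_trans; apply; rewrite gerBl divr_ge0.
elim: N => [|N IH]; first by rewrite big_ord1 /= expr0n addr0 invr1; lra.
rewrite big_ord_recr /= (le_trans (lerD IH (lexx _)))//.
have N0 : 0 <= N%:R :> R by [].
rewrite (_ : N.+2%:R = N%:R + 1 + 1 :> R); last by rewrite -!natr1.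
rewrite (_ : N.+1%:R = N%:R + 1 :> R); last by rewrite -natr1.
move: (N%:R : R) N0 => z z0; rewrite -subr_ge0.
have -> : 3 - 2 / (z + 1 + 1) - (3 - 2 / (z + 1) + (1 + (z + 1) ^+ 2)^-1) =
  (z ^+ 2 + z + 2) / ((z + 1) * (z + 1 + 1) * (1 + (z + 1) ^+ 2)).
  by field; rewrite !lt0r_neq0//; nra.
by apply: divr_ge0; nra.
Qed.

Lemma sum_inv_sqr_dist_le N q :
  \sum_(r < N) (1 + (r%:R - q%:R) ^+ 2)^-1 <= 6 :> R.
Proof.
suff H : forall q N, \sum_(r < N) (1 + (r%:R - q%:R) ^+ 2)^-1 <=
    \sum_(h < q.+1) (1 + h%:R ^+ 2)^-1 + \sum_(h < N) (1 + h%:R ^+ 2)^-1 :> R.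
  rewrite (le_trans (H q N))// (_ : 6 = 3 + 3); last by ring.
  by rewrite lerD// sum_inv_sqr_le.
have pos (z : R) : 0 <= (1 + z ^+ 2)^-1 by rewrite invr_ge0 addr_ge0// sqr_ge0.
elim=> {q N} [|q IH] N.
  rewrite (eq_bigr (fun h : 'I_N => (1 + h%:R ^+ 2)^-1)) => [|r _].
    by rewrite lerDr sumr_ge0.
  by rewrite subr0.
case: N => [|N]; first by rewrite !big_ord0 addr0 sumr_ge0.
rewrite big_ord_recl sub0r sqrrN addrC /=.
under eq_bigr => r _ do rewrite -!natr1 opprD addrACA subrr addr0.
rewrite big_ord_recr /= addrAC lerD2r.
apply: le_trans (IH N) _; rewrite lerD2l.
by rewrite [leRHS]big_ord_recr /= lerDl.
Qed.

(** A characteristic function that is small beyond the scale [1 / sqrt B] means that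
    the sum is spread over the scale [sqrt B], so that a window of radius [C]
    carries a mass of order [C / sqrt B]; [A] absorbs the frequencies for which
    only a uniform bound is known. *)
Lemma concentration_of_decay n a A B C x : 0 <= A -> 0 < B -> 1 <= C ->
  (forall phi, 0 <= phi <= 1 ->
    `|\prod_(k < n) cos (phi * a k)| <= A + (1 + B * phi ^+ 2)^-1) ->
  sign_mean n (fun s => (`|signed_sum a s - x| <= C)%R%:R) <=
  4 * A + 48 * C / Num.sqrt B.
Proof.
move=> A0 B0 C1 H; have C0 : 0 < C by rewrite (lt_le_trans ltr01).
have sB : 0 < Num.sqrt B by rewrite sqrtr_gt0.
have [small|large] := leP (Num.sqrt B) C.
  apply: (@le_trans _ _ (sign_mean n (fun=> 1))).
    by apply: le_sign_mean => s _; rewrite lern1 leq_b1.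
  rewrite sign_mean_cst -[leLHS]add0r lerD ?mulr_ge0// ler_pdivlMr// mul1r.
  by rewrite (le_trans small)// ler_peMl ?ltW//; lra.
(* The largest number of frequencies for which the assumed decay at step
   [1 / (C N)] is still at least as fast as that of [1 / (1 + h ^ 2)]. *)
pose N := Num.truncn (Num.sqrt B / C).
have BC1 : 1 <= Num.sqrt B / C by rewrite ler_pdivlMr// mul1r ltW.
have N0 : (0 < N)%N by rewrite truncn_gt0.
have N0' : 1 <= N%:R :> R by rewrite ler1n.
have /andP[NB BN] := truncn_itv (le_trans ler01 BC1).
rewrite -/N ler_pdivlMr// in NB; rewrite -/N ltr_pdivrMr// -natr1 in BN.
apply: le_trans (esseen_concentration n a x N0 C0) _.
have CN : 0 < C * N%:R by rewrite mulr_gt0// (lt_le_trans ltr01).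
have Hr (r q : 'I_N) : `|\prod_(k < n) cos ((r%:R - q%:R) / (C * N%:R) * a k)| <=
    A + (1 + (r%:R - q%:R) ^+ 2)^-1.
  set h : R := r%:R - q%:R.
  have hN : `|h| <= N%:R.
    have := ltn_ord r; have := ltn_ord q; rewrite -!(ltr_nat R) => qN rN.
    rewrite ler_norml /h; have := ler0n R r; have := ler0n R q; lra.
  have -> : `|\prod_(k < n) cos (h / (C * N%:R) * a k)| =
      `|\prod_(k < n) cos (`|h / (C * N%:R)| * a k)|.
    congr `| _ |; apply: eq_bigr => k _.
    by rewrite -cos_norm -[in RHS]cos_norm !normrM !normr_id.
  have h1 : 0 <= `|h / (C * N%:R)| <= 1.
    rewrite normr_ge0 normrM normfV (gtr0_norm CN) ler_pdivrMr// mul1r.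
    by rewrite (le_trans hN)// ler_peMl.
  apply: le_trans (H _ h1) _; rewrite lerD2l.
  have pos (z : R) : 0 <= z -> 0 < 1 + z by lra.
  rewrite lef_pV2 ?posrE ?pos ?(mulr_ge0 (ltW B0)) ?sqr_ge0//.
  rewrite lerD2l real_normK ?num_real// expr_div_n mulrA ler_pdivlMr ?exprn_gt0//.
  rewrite [leRHS]mulrC; apply: ler_wpM2l; first exact: sqr_ge0.
  rewrite -[leRHS](sqr_sqrtr (ltW B0)).
  by rewrite ler_pXn2r ?nnegrE ?(ltW CN) ?(ltW sB)// mulrC.
apply: (@le_trans _ _ (4 / N%:R ^+ 2 * (N%:R * (N%:R * A + 6)))).
  rewrite ler_wpM2l ?divr_ge0 ?exprn_ge0//.
  rewrite (_ : N%:R * _ = \sum_(r < N) (N%:R * A + 6)); last first.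
    by rewrite sumr_const card_ord mulr_natl.
  rewrite exchange_big; apply: ler_sum => q _.
  apply: le_trans (ler_sum _ (fun r _ => Hr r q)) _.
  rewrite big_split /= sumr_const card_ord mulr_natl lerD2l.
  exact: sum_inv_sqr_dist_le.
have -> : 4 / N%:R ^+ 2 * (N%:R * (N%:R * A + 6)) = 4 * A + 24 / N%:R.
  by field; rewrite lt0r_neq0// (lt_le_trans ltr01).
rewrite lerD2l ler_pdivrMr ?(lt_le_trans ltr01)// mulrAC ler_pdivlMr//.
nra.
Qed.

End Concentration.

(** * Decay of the characteristic function when the speed runs through the integers *)

Section LinearSpeed.
Context {R : realType}.
Implicit Types (phi A B C : R) (a : nat -> R) (c : nat -> nat).

Lemma le_sum_nat_subset (F : nat -> R) m n u v :
  (forall j, 0 <= F j) -> (u <= m)%N -> (n <= v)%N ->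
  \sum_(m <= j < n) F j <= \sum_(u <= j < v) F j.
Proof.
move=> F0 um nv; have [nm|/ltnW mn] := leqP n m.
  by rewrite big_geq// sumr_ge0.
rewrite (@big_cat_nat _ _ _ m u v)//= ?(leq_trans mn)//.
rewrite (@big_cat_nat _ _ _ n m v)//= addrA.
by rewrite -[leLHS]add0r -[leLHS]addr0 !lerD ?sumr_ge0.
Qed.

(** Two integers [d] apart cannot both be nearly multiples of [pi / phi] unless [d]
    is, so in each pair [j], [j + d] at least one term of the sum is comparable to
    [sin (d phi) ^ 2]. *)
Lemma sum_sin_sqr_ge_shift (p d : nat) phi : (d <= p)%N ->
  p%:R / 4 * sin (phi * d%:R) ^+ 2 <=
  \sum_(2 * p <= j < 4 * p) sin (phi * j%:R) ^+ 2.
Proof.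
move=> dp; set S := \sum_(_ <= _ < _) _; set s := sin _ ^+ 2.
pose F j : R := sin (phi * j%:R) ^+ 2.
have F0 j : 0 <= F j by rewrite sqr_ge0.
have pointwise j : s <= 2 * (F (j + d)%N + F j).
  rewrite /s (_ : phi * d%:R = phi * (j + d)%:R - phi * j%:R); last first.
    by rewrite natrD; ring.
  rewrite sinB /F; move: (phi * (j + d)%:R) (phi * j%:R) => x y.
  have := cos2Dsin2 x; have := cos2Dsin2 y.
  move: (sin x) (sin y) (cos x) (cos y) => sx sy cx cy hy hx.
  (* The square of the difference is at most twice the sum of the squares. *)
  have : 0 <= (sx * cy + cx * sy) ^+ 2 by exact: sqr_ge0.
  have : sx ^+ 2 * cy ^+ 2 <= sx ^+ 2.
    by rewrite ler_piMr ?sqr_ge0// -hy lerDl sqr_ge0.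
  have : cx ^+ 2 * sy ^+ 2 <= sy ^+ 2.
    by rewrite ler_piMl ?sqr_ge0// -hx lerDl sqr_ge0.
  nra.
have : \sum_(2 * p <= j < 3 * p) s <= 2 * (S + S).
  apply: le_trans (ler_sum _ (fun j _ => pointwise j)) _.
  rewrite -mulr_sumr ler_wpM2l// big_split /= lerD//; last first.
    by apply: le_sum_nat_subset => //; rewrite leq_mul2r orbT.
  have -> : \sum_(2 * p <= j < 3 * p) F (j + d)%N =
      \sum_(2 * p + d <= j < 3 * p + d) F j by rewrite (big_addn (2 * p) (3 * p + d) d) addnK.
  by apply: le_sum_nat_subset => //; lia.
rewrite sumr_const_nat (_ : 3 * p - 2 * p = p)%N; last by lia.
by rewrite -mulr_natr; lra.
Qed.

(** While [sin x ^ 2] stays below 1/4, [sin (2 x) ^ 2 = 4 sin x ^ 2 cos x ^ 2] is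
    at least three times as large as [sin x ^ 2]. *)
Lemma sin_doubling_ge phi (i : nat) : exists2 d, (0 < d <= 2 ^ i)%N &
  Num.min (4^-1) (3 ^+ i * sin phi ^+ 2) <= sin (phi * d%:R) ^+ 2.
Proof.
elim: i => [|i [d /andP[d0 di] IH]].
  by exists 1%N; rewrite // mulr1 expr0 mul1r ge_min lexx orbT.
have [big|small] := leP (4^-1) (sin (phi * d%:R) ^+ 2).
  exists d; last by rewrite ge_min big.
  by rewrite d0 (leq_trans di)// leq_exp2l.
exists (d * 2)%N; first by rewrite muln_gt0 d0 expnSr leq_mul.
rewrite ge_min; apply/orP; right.
have : 3 ^+ i * sin phi ^+ 2 <= sin (phi * d%:R) ^+ 2.
  by move: IH; rewrite ge_min leNgt small.
rewrite natrM mulrA (mulr_natr _ 2) sin_mulr2n (exprS 3 i) -(mulrA 3).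
move: (phi * d%:R) small => x small; rewrite -(mulr_natr _ 2).
rewrite (_ : (_ * _ * 2) ^+ 2 = 4 * (cos x ^+ 2 * sin x ^+ 2)); last by ring.
rewrite cos2sin2; have := sqr_ge0 (sin x); move: (sin x ^+ 2) small => z.
move: (3 ^+ i * _) => w.
nra.
Qed.

Lemma expRN_le_inv (v : R) : 0 <= v -> expR (- v) <= (1 + v)^-1.
Proof.
move=> v0; rewrite expRN lef_pV2 ?posrE ?expR_gt0 ?expR_ge1Dx//.
by rewrite (lt_le_trans ltr01)// lerDl.
Qed.

Lemma expRN_le_inv_sqr (u : R) : 0 < u -> expR (- u) <= 2 / u ^+ 2.
Proof.
move=> u0; rewrite expRN -[2]invrK -invfM lef_pV2 ?posrE ?expR_gt0//; last first.
  by rewrite mulr_gt0 ?exprn_gt0.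
rewrite (le_trans _ (expR_ge1Dxn 1 (ltW u0)))// mulrC.
by rewrite (_ : 2`! = 2)%N// lerDr.
Qed.

Lemma sum_blocks a c (f : R -> R) u v :
  (forall j k, (u <= j)%N -> (c j <= k < c j.+1)%N -> a k = j%:R) ->
  (forall j, (u <= j)%N -> (c j <= c j.+1)%N) -> (u <= v)%N ->
  \sum_(c u <= k < c v) f (a k) = \sum_(u <= j < v) (c j.+1 - c j)%:R * f j%:R.
Proof.
move=> ac cc; elim: v => [|v IH].
  by rewrite leqn0 => /eqP ->; rewrite !big_geq.
rewrite leq_eqVlt => /orP[/eqP <-|]; first by rewrite !big_geq.
rewrite ltnS => uv.
have cuv : (c u <= c v)%N.
  elim: v uv {IH} => [|v IHv]; first by rewrite leqn0 => /eqP ->.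
  rewrite leq_eqVlt => /orP[/eqP <-//|]; rewrite ltnS => uv.
  by rewrite (leq_trans (IHv uv))// cc.
rewrite (@big_cat_nat _ _ _ (c v))//= ?cc// big_nat_recr//= IH//; congr (_ + _).
rewrite (@eq_big_nat _ _ _ _ _ _ (fun=> f v%:R)) => [|k vk]; last by rewrite (ac v)//.
by rewrite sumr_const_nat mulr_natl.
Qed.

(** The two terms correspond to the two cases of [sin_doubling_ge]. For a frequency
    that some doubling makes macroscopic, a positive fraction of the speeds gives
    a fixed gain, whence an exponent of order [Lam 2 ^ i]; otherwise the gain per
    step is of order [3 ^ i phi ^ 2], whence [2 ^ i 3 ^ i = 6 ^ i]. Inverse powers
    replace the exponentials since they are all that is needed later. *)
Lemma block_cos_decay a c (i n : nat) (Lam phi : R) :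
  (forall j k, (0 < j)%N -> (c j <= k < c j.+1)%N -> a k = j%:R) ->
  (forall j, (0 < j)%N -> (c j <= c j.+1)%N) ->
  (c (4 * 2 ^ i) <= n)%N -> 0 < Lam ->
  (forall j, (2 * 2 ^ i <= j < 4 * 2 ^ i)%N -> Lam <= (c j.+1 - c j)%:R) ->
  0 <= phi <= 1 ->
  `|\prod_(k < n) cos (phi * a k)| <=
    2 / (Lam * 2 ^+ i / 32) ^+ 2 + (1 + Lam * 6 ^+ i / 32 * phi ^+ 2)^-1.
Proof.
move=> ac cc cn Lam0 LamL phi01; set p := (2 ^ i)%N in cn LamL *.
have pE : p%:R = 2 ^+ i :> R by rewrite natrX.
have p0 : (0 < p)%N by rewrite expn_gt0.
set u := Lam * _ / 32; set v := Lam * 6 ^+ i / 32 * phi ^+ 2.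
have u0 : 0 < u by rewrite !mulr_gt0 ?invr_gt0 ?exprn_gt0.
have v0 : 0 <= v.
  by rewrite mulr_ge0 ?sqr_ge0// divr_ge0// mulr_ge0 ?exprn_ge0// ltW.
apply: (@le_trans _ _ (expR (- Num.min u v))); last first.
  rewrite minElt; case: ifP => _.
    by rewrite -[leLHS]addr0 lerD ?expRN_le_inv_sqr// invr_ge0 addr_ge0.
  by rewrite -[leLHS]add0r lerD ?expRN_le_inv// divr_ge0 ?sqr_ge0.
rewrite normr_prod.
apply: (@le_trans _ _ (\prod_(k < n) expR (- (sin (phi * a k) ^+ 2 / 2)))).
  by apply: ler_prod => k _; rewrite normr_ge0 ler_norm_cos_expR.
rewrite -expR_sum ler_expR sumrN lerN2 -mulr_suml ler_pdivlMr//.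
apply: (@le_trans _ _ (\sum_(c (2 * p) <= k < c (4 * p)) sin (phi * a k) ^+ 2)).
  rewrite (@sum_blocks a c (fun x => sin (phi * x) ^+ 2)); first last.
  - by rewrite leq_mul2r orbT.
  - by move=> j pj; apply: cc; rewrite (leq_trans _ pj)// muln_gt0.
  - by move=> j k pj; apply: ac; rewrite (leq_trans _ pj)// muln_gt0.
  apply: (@le_trans _ _ (Lam * \sum_(2 * p <= j < 4 * p) sin (phi * j%:R) ^+ 2)).
    have [d /andP[_ dp] H] := sin_doubling_ge phi i.
    have := sum_sin_sqr_ge_shift phi dp; move: (\sum_(_ <= _ < _) _) => S HS.
    rewrite -/p pE in HS.
    apply: (@le_trans _ _ (Lam * (2 ^+ i / 4 * Num.min 4^-1 (3 ^+ i * sin phi ^+ 2)))).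
      have sphi : phi ^+ 2 / 4 <= sin phi ^+ 2.
        have := sin_ge_half phi01; case/andP: phi01; nra.
      have w0 : 0 <= Lam * 2 ^+ i by rewrite mulr_ge0 ?exprn_ge0// ltW.
      have t0 : 0 <= 3 ^+ i :> R by rewrite exprn_ge0.
      have vE : v = Lam * 2 ^+ i * 3 ^+ i / 32 * phi ^+ 2.
        rewrite /v (_ : 6 ^+ i = 2 ^+ i * 3 ^+ i); first by ring.
        by rewrite -exprMn; congr (_ ^+ _); ring.
      have [mu mv] : Num.min u v <= u /\ Num.min u v <= v by rewrite !ge_min !lexx orbT.
      rewrite [Num.min 4^-1 _]minElt; case: ifP => _.
        by apply: le_trans (ler_wpM2r _ mu) _ => //; rewrite /u; lra.
      apply: le_trans (ler_wpM2r _ mv) _ => //; rewrite vE.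
      have := ler_wpM2l (mulr_ge0 w0 t0) sphi; move: (2 ^+ i) (3 ^+ i) => e t.
      lra.
    apply: ler_wpM2l; first exact: ltW.
    by apply: le_trans HS; apply: ler_wpM2l => //; rewrite divr_ge0 ?exprn_ge0.
  rewrite mulr_sumr !big_nat; apply: ler_sum => j pj.
  by rewrite ler_wpM2r ?sqr_ge0// LamL.
rewrite -(big_mkord xpredT (fun k => sin (phi * a k) ^+ 2)).
by apply: le_sum_nat_subset => // k; rewrite sqr_ge0.
Qed.

(** The second term has the order of [C] divided by a standard deviation; the first
    one is smaller than it by a power of [2 ^ i] as soon as [Lam >= 1]. *)
Lemma block_concentration a c (i n : nat) (Lam C x : R) :
  (forall j k, (0 < j)%N -> (c j <= k < c j.+1)%N -> a k = j%:R) ->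
  (forall j, (0 < j)%N -> (c j <= c j.+1)%N) ->
  (c (4 * 2 ^ i) <= n)%N -> 0 < Lam ->
  (forall j, (2 * 2 ^ i <= j < 4 * 2 ^ i)%N -> Lam <= (c j.+1 - c j)%:R) ->
  1 <= C ->
  sign_mean n (fun s => (`|signed_sum a s - x| <= C)%R%:R) <=
    4 * (2 / (Lam * 2 ^+ i / 32) ^+ 2) + 48 * C / Num.sqrt (Lam * 6 ^+ i / 32).
Proof.
move=> ac cc cn Lam0 LamL C1; apply: concentration_of_decay => //.
- by rewrite divr_ge0 ?sqr_ge0.
- by rewrite !mulr_gt0 ?invr_gt0 ?exprn_gt0.
- by move=> phi phi01; apply: (block_cos_decay ac).
Qed.

End LinearSpeed.

(** * Visits to a window during a run of constant speed *)

Section Runs.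
Context {R : realType}.
Implicit Types (e b : bool) (s t : seq bool) (L n : nat) (a : nat -> R).

(** The maximum (for [e = true]) or minus the minimum (for [e = false]) of the
    partial sums of the signs in [t], the empty one included. Read from the
    right end of [t] this is a walk reflected at [0]. *)
Fixpoint reach e t : nat :=
  if t is b :: t' then if b == e then (reach e t').+1 else (reach e t').-1
  else 0.

(** The partial sums stay between minus [reach false t] and [reach true t]; the pair
    [e], [v] is the sign and the modulus of the partial sum. *)
Lemma partial_sign_sum_reach t i : exists e v,
  (v <= reach e t)%N /\ signed_sum (fun=> 1) (take i t) = sgn e * v%:R :> R.
Proof.
elim: t i => [|b t IH] [|i] /=; try by exists true, 0%N; rewrite mulr0.
have [e [v [vr ->]]] := IH i; rewrite mulr1.
have [eb|be] := eqVneq b e.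
  subst e.
  by exists b, v.+1; rewrite eqxx -natr1; split=> //; ring.
case: v vr => [|v] vr.
  by exists b, 1%N; rewrite eqxx mulr0 addr0 mulr1.
exists e, v; rewrite (negbTE be); split; first by case: (reach e t) vr.
rewrite -natr1; case: b e be {vr} => [] [] //= _; rewrite /sgn; ring.
Qed.

(** A free step increases the mean square by exactly one, and the reflection at [0]
    can only decrease it. *)
Lemma sign_mean_reach_sqr e L :
  sign_mean L (fun t => (reach e t)%:R ^+ 2) <= L%:R :> R.
Proof.
elim: L => [|L IH] /=; first by rewrite expr0n.
rewrite ler_pdivrMr// -sign_meanD.
apply: (@le_trans _ _ (sign_mean L (fun t => 2 * ((reach e t)%:R ^+ 2 + 1)))).
  apply: le_sign_mean => t _.
  have H (r : nat) : (r.+1%:R ^+ 2 + r.-1%:R ^+ 2 : R) <= 2 * (r%:R ^+ 2 + 1).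
    case: r => [|r]; first by rewrite expr0n /=; lra.
    by rewrite -!natr1 /=; lra.
  by case: e {IH} => /=; [|rewrite addrC]; exact: H.
by rewrite sign_meanZ sign_meanD sign_mean_cst -natr1; lra.
Qed.

Lemma sign_mean_reach e L :
  sign_mean L (fun t => (reach e t)%:R) <= Num.sqrt L%:R :> R.
Proof.
case: L => [|L]; first by rewrite /= sqrtr0.
set q : R := Num.sqrt _.
have q0 : 0 < q by rewrite sqrtr_gt0 ltr0n.
have q2 : q ^+ 2 = L.+1%:R by rewrite sqr_sqrtr.
apply: (@le_trans _ _ (sign_mean L.+1
    (fun t => (2 * q)^-1 * ((reach e t)%:R ^+ 2 + q ^+ 2)))).
  apply: le_sign_mean => t _; rewrite mulrC ler_pdivlMr ?mulr_gt0//.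
  by have := sqr_ge0 ((reach e t)%:R - q); nra.
rewrite sign_meanZ sign_meanD sign_mean_cst mulrC ler_pdivrMr ?mulr_gt0//.
by have := sign_mean_reach_sqr e L.+1; rewrite -q2; nra.
Qed.

Definition visits_window a (C : R) n L s : bool :=
  [exists i : 'I_L.+1, `|signed_sum a (take (n + i) s)| <= C].

(** Along a run of constant speed [m] the walk visits points [x + m v] with [v]
    in the range of a simple random walk, which has about [sqrt L] points; the
    small-ball bound at the start of the run applies to each of them. *)
Lemma sign_mean_visits_window a (C Q m : R) n L :
  (forall i, (i < L)%N -> a (n + i)%N = m) ->
  (forall x, sign_mean n (fun s => (`|signed_sum a s - x| <= C)%R%:R) <= Q) ->
  sign_mean (n + L) (fun s => (visits_window a C n L s)%:R) <=
  Q * (2 + 2 * Num.sqrt L%:R).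
Proof.
move=> am HQ.
have Q0 : 0 <= Q.
  apply: le_trans (HQ 0); rewrite -[leLHS](sign_mean_cst n).
  by apply: le_sign_mean => s _.
rewrite sign_mean_cat exchange_sign_mean.
apply: (@le_trans _ _ (sign_mean L (fun t =>
    Q * ((reach true t)%:R + 1 + ((reach false t)%:R + 1))))); last first.
  rewrite sign_meanZ ler_wpM2l// !sign_meanD !sign_mean_cst.
  by have := sign_mean_reach true L; have := sign_mean_reach false L; lra.
apply: le_sign_mean => t tL.
pose hit e v s : R := (`|signed_sum a s - m * (- sgn e * v%:R)| <= C)%R%:R.
apply: (@le_trans _ _ (sign_mean n (fun s =>
    \sum_(v < (reach true t).+1) hit true v s +
    \sum_(v < (reach false t).+1) hit false v s))).
  apply: le_sign_mean => s sn.
  have sum0 e : 0 <= \sum_(v < (reach e t).+1) hit e v s by apply: sumr_ge0.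
  case: (boolP (visits_window _ _ _ _ _)) => [/existsP[i Hi]|_]; last first.
    by rewrite addr_ge0 ?sum0.
  have [e [v [vr vE]]] := partial_sign_sum_reach t i.
  suff : 1 <= \sum_(v < (reach e t).+1) hit e v s.
    move=> H; apply: le_trans H _.
    by case: e {vr vE}; rewrite ?lerDl ?lerDr ?sum0.
  rewrite (bigD1 (Ordinal (vr : v < (reach e t).+1)%N))//=.
  rewrite -[leLHS]addr0 lerD ?sumr_ge0//.
  rewrite /hit (_ : _ - _ = signed_sum a (take (n + i) (s ++ t))) ?Hi//.
  rewrite take_cat sn ltnNge leq_addr /= addKn signed_sum_cat sn mulNr mulrN opprK.
  congr (_ + _); rewrite -vE.
  rewrite (@eq_signed_sum _ (fun k => a (n + k)%N) (fun=> m)) => [|j]; last first.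
    by rewrite size_take tL => ji; apply: am; case: ifP ji; lia.
  by rewrite !signed_sum_nth mulr_sumr; apply: eq_bigr => k _; rewrite mul1r.
rewrite sign_meanD mulrDr; apply: lerD; rewrite sign_mean_sum;
  by apply: (le_trans (ler_sum _ (fun v _ => HQ _)));
    rewrite sumr_const card_ord -[leLHS]mulr_natr -natr1.
Qed.

End Runs.

(** * From averages over signs to probabilities *)

Section SignEvents.
Local Open Scope classical_set_scope.
Context {R : realType} {d : measure_display} {T : measurableType d}.
Context {P : probability T R} (X : nat -> {RV P >-> R}).
Context (X_indep : independent_RVs X) (X_sign : forall k, rademacher (X k)).
Implicit Types (u t : seq bool) (F : seq bool -> bool).

Definition cylinder u : set T :=
  \bigcap_(k in `I_(size u)) (X k @^-1` [set sgn (nth false u k)]).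

Lemma measurable_cylinder u : measurable (cylinder u).
Proof.
apply: fin_bigcap_measurable; first exact: finite_II.
by move=> k _; apply: measurable_funPTI.
Qed.

Lemma prob_cylinder u : P (cylinder u) = ((2^-1) ^+ size u)%:E.
Proof.
pose n := size u; pose N := [fset k in iota 0 n]%fset.
pose B k : set R := [set sgn (nth false u k)].
have NE : [set` N] = `I_n by apply/seteqP; split=> k /=; rewrite in_fset /= mem_iota.
rewrite /cylinder -/n -NE (X_indep _ (B := B)); last by move=> k; exact: measurable_set1.
under eq_bigr => k _.
  rewrite (_ : P _ = (2^-1)%:E); last first.
    by have [H1 H2] := X_sign k; rewrite /B /sgn; case: (nth _ _ _).
  over.
rewrite big_const_seq count_predT (_ : size N = n); last first.
  rewrite -[LHS]/(#|` N|) card_fseq undup_id ?iota_uniq// size_iota//.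
by elim: n {N NE} => //= n IH; rewrite IH -EFinM -exprS.
Qed.

(** The prefix [u] is there for the induction on [n], which splits an event according
    to its next sign. *)
Definition sign_event u n F : set T :=
  [set w | exists t, [/\ size t = n, F (u ++ t) & cylinder (u ++ t) w]].

Lemma sign_event0 u F : sign_event u 0 F = if F u then cylinder u else set0.
Proof.
apply/seteqP; split=> [w [t [/size0nil ->]]|w]; first by rewrite cats0 => ->.
by case: ifP => // Fu uw; exists [::]; rewrite cats0.
Qed.

Lemma sign_eventS u n F : sign_event u n.+1 F =
  sign_event (rcons u true) n F `|` sign_event (rcons u false) n F.
Proof.
apply/seteqP; split=> [w [t []]|w].
  case: t => [|b t] // [tn] Ft uw.
  by case: b Ft uw; [left|right]; exists t; rewrite cat_rcons.
by case=> -[t [tn Ft uw]]; [exists (true :: t)|exists (false :: t)];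
  rewrite -cat_rcons /= tn.
Qed.

Lemma measurable_sign_event u n F : measurable (sign_event u n F).
Proof.
elim: n u => [|n IH] u.
  by rewrite sign_event0; case: ifP => _; [exact: measurable_cylinder|].
by rewrite sign_eventS; apply: measurableU.
Qed.

Lemma prob_sign_event_le u n F : (P (sign_event u n F) <=
  ((2^-1) ^+ size u * sign_mean n (fun t => (F (u ++ t))%:R))%:E)%E.
Proof.
elim: n u => [|n IH] u.
  rewrite sign_event0 /= cats0; case: ifP => _.
    by rewrite prob_cylinder mulr1.
  by rewrite measure0 mulr0.
rewrite sign_eventS; apply: le_trans (measureU2 _ _ _) _;
  [exact: measurable_sign_event|exact: measurable_sign_event|].
apply: le_trans (leeD (IH _) (IH _)) _.
rewrite -EFinD lee_fin !size_rcons exprS /=.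
have E b : sign_mean n (fun t => (F (rcons u b ++ t))%:R) =
    sign_mean n (fun t => (F (u ++ b :: t))%:R) :> R.
  by apply: eq_sign_mean => t _; rewrite cat_rcons.
by rewrite !E; lra.
Qed.

Lemma ae_sign : {ae P, forall w, forall k, X k w = 1 \/ X k w = -1}.
Proof.
apply: ae_foralln => k; have [H1 H2] := X_sign k.
pose A := X k @^-1` [set 1] `|` X k @^-1` [set -1].
have mX (x : R) : measurable (X k @^-1` [set x]) by apply: measurable_funPTI.
have mA : measurable A by apply: measurableU; exact: mX.
have PA : P A = 1%:E.
  transitivity (P (X k @^-1` [set 1%R]) + P (X k @^-1` [set (-1)%R]))%E.
    apply: measureU; [exact: mX|exact: mX|].
    apply/seteqP; split=> // w [/= ->] H.
    by exfalso; clear H1 H2 mX mA A; lra.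
  by rewrite H1 H2 -EFinD; congr EFin; lra.
exists (~` A); split; first exact: measurableC.
  by rewrite [LHS]probability_setC// PA subee.
by move=> w /= nA Aw; apply: nA; case: Aw; [left|right].
Qed.

(** On the almost sure event that all steps are signs, the trajectory can be read
    off from the sequence of booleans telling which steps are positive. *)
Lemma walk_sign_event a F n w : (forall k, X k w = 1 \/ X k w = -1) ->
  let s := mkseq (fun k => X k w == 1) n in
  (forall i, (i <= n)%N -> walk a X i w = signed_sum a (take i s)) /\
  (F s -> sign_event [::] n F w).
Proof.
move=> Xw s; have sgnE k : sgn (X k w == 1) = X k w.
  case: (Xw k) => ->; first by rewrite eqxx.
  by rewrite /sgn ifF//; apply/eqP; lra.
have nth_s k : (k < n)%N -> sgn (nth false s k) = X k w.
  by move=> kn; rewrite nth_mkseq.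
split=> [i i_n|Fs].
  rewrite signed_sum_nth size_takel ?size_mkseq//; apply: eq_bigr => k _.
  by rewrite nth_take// nth_s// (leq_trans (ltn_ord k)).
exists s; split=> //; first by rewrite size_mkseq.
by move=> k /=; rewrite size_mkseq => kn; rewrite /= nth_s.
Qed.

End SignEvents.

(** * Transience of a walk whose speed increases by unit steps *)

Section Transience.
Local Open Scope classical_set_scope.
Context {R : realType} {d : measure_display} {T : measurableType d}.
Context {P : probability T R} (X : nat -> {RV P >-> R}).
Context (X_indep : independent_RVs X) (X_sign : forall k, rademacher (X k)).

Lemma ae_eventually_not_geometric (A : nat -> set T) (M q : R) :
  0 <= M -> 0 <= q < 1 -> (forall i, measurable (A i)) ->
  (forall i, (P (A i) <= (M * q ^+ i)%:E)%E) ->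
  {ae P, forall w, exists N, forall i, (N <= i)%N -> ~ A i w}.
Proof.
move=> M0 /andP[q0 q1] mA PA.
have mlim : measurable (lim_sup_set A).
  by apply: bigcapT_measurable => n; apply: bigcup_measurable.
exists (lim_sup_set A); split=> //.
  apply: lim_sup_set_cvg0 => //.
  apply: (@le_lt_trans _ _ (M / (1 - q))%:E); last exact: ltry.
  apply: lime_le; first by apply: is_cvg_nneseries => n _ _.
  apply: nearW => n.
  apply: le_trans (lee_sum _ (fun i _ => PA i)) _.
  rewrite sumEFin lee_fin -mulr_sumr ler_wpM2l// big_mkord.
  elim: n => [|n IH]; first by rewrite big_ord0 invr_ge0; lra.
  rewrite big_ord_recl expr0; under eq_bigr => i _ do rewrite exprS.
  rewrite -mulr_sumr (le_trans (lerD (lexx _) (ler_wpM2l q0 IH)))//.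
  rewrite le_eqVlt; apply/orP; left; apply/eqP; field; lra.
move=> w /= H n _; apply: contra_notP H => nA.
by exists n => i ni Aw; apply: nA; exists i.
Qed.

Context (a : nat -> R) (c : nat -> nat) (K : R).
Context (a_run :
  forall j k, (0 < j)%N -> (c j <= k < c j.+1)%N -> a k = j%:R).
Context (c_incr : forall j, (0 < j)%N -> (c j < c j.+1)%N).
Context (run_length_doubling : forall j m, (0 < j <= m)%N -> (m <= 4 * j)%N ->
  (c m.+1 - c m)%:R <= K * (c j.+1 - c j)%:R).

Definition run_visits (C : R) (m : nat) : set T :=
  sign_event X [::] (c m.+1) (visits_window a C (c m) (c m.+1 - c m)).

(** The length [L] of the run enters through [sqrt L], the size of the range during
    the run, and through [1 / sqrt L], the small-ball bound with
    [Lam = L / K]; the two cancel. The number 5/12 is a rational upper bound for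
    [1 / sqrt 6], still below 1/2, which the number of runs in a dyadic group
    requires. *)
Lemma prob_run_visits_le (C : R) i m : 1 <= C ->
  (4 * 2 ^ i <= m < 8 * 2 ^ i)%N ->
  (P (run_visits C m) <=
    ((32 * (32 * K) ^+ 2 + 192 * C * Num.sqrt (32 * K)) * (5 / 12) ^+ i)%:E)%E.
Proof.
move=> C1 /andP[im mi].
have p0 : (0 < 2 ^ i)%N by rewrite expn_gt0.
have m0 : (0 < m)%N by rewrite (leq_trans _ im)// muln_gt0.
apply: le_trans (prob_sign_event_le X_indep X_sign _ _ _) _.
rewrite expr0 mul1r lee_fin /=.
have K1 : 1 <= K.
  have := @run_length_doubling 1 1 isT isT.
  have : 0 < (c 2 - c 1)%:R :> R by rewrite ltr0n subn_gt0 c_incr.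
  nra.
set L := (c m.+1 - c m)%N.
have L1 : 1 <= L%:R :> R by rewrite ler1n subn_gt0 c_incr.
have -> : c m.+1 = (c m + L)%N by rewrite subnKC// ltnW// c_incr.
have L0 : 0 < L%:R :> R by rewrite (lt_le_trans ltr01).
have K0 : 0 < K by rewrite (lt_le_trans ltr01).
have cm : (c (4 * 2 ^ i) <= c m)%N.
  elim: m im {m0 mi L L1 L0} => [|m IH]; first by rewrite leqn0 => /eqP ->.
  rewrite leq_eqVlt => /orP[/eqP ->//|]; rewrite ltnS => im.
  by rewrite (leq_trans (IH im))// ltnW// c_incr// (leq_trans _ im)// muln_gt0.
pose Lam : R := L%:R / K.
have Lam0 : 0 < Lam by rewrite divr_gt0.
have small_ball x := @block_concentration R a c i (c m) Lam C x a_run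
  (fun j j0 => ltnW (c_incr j0)) cm Lam0.
pose Q : R := 4 * (2 / (Lam * 2 ^+ i / 32) ^+ 2) + 48 * C / Num.sqrt (Lam * 6 ^+ i / 32).
apply: le_trans (sign_mean_visits_window (m := m%:R) (Q := Q) _ _) _.
- by move=> k kL; apply: a_run => //; rewrite /L in kL; lia.
- move=> x; apply: small_ball => // j /andP[ij ji].
  rewrite ler_pdivrMr// mulrC; apply: run_length_doubling; lia.
have w0 : 0 < 2 ^+ i :> R by rewrite exprn_gt0.
set s := Num.sqrt L%:R.
have s1 : 1 <= s by rewrite -sqrtr1 ler_wsqrtr.
have sL : s ^+ 2 = L%:R by rewrite sqr_sqrtr// ltW.
have s0 : 0 < s by rewrite (lt_le_trans ltr01).
set k := Num.sqrt (32 * K).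
have k0 : 0 < k by rewrite sqrtr_gt0 mulr_gt0.
(* Here [s ^ 4 = L ^ 2] in the denominator beats the factor [s], and 1/4 is less
   than 5/12. *)
have first_term : 4 * (2 / (Lam * 2 ^+ i / 32) ^+ 2) * s <=
    8 * (32 * K) ^+ 2 * (5 / 12) ^+ i.
  have -> : 4 * (2 / (Lam * 2 ^+ i / 32) ^+ 2) * s =
      8 * (32 * K) ^+ 2 * ((4^-1) ^+ i / s ^+ 3).
    rewrite /Lam -sL exprVn (_ : 4 ^+ i = 2 ^+ i * 2 ^+ i); last first.
      by rewrite -exprMn; congr (_ ^+ _); ring.
    by field; rewrite !lt0r_neq0.
  apply: ler_wpM2l; first by rewrite mulr_ge0 ?sqr_ge0.
  rewrite ler_pdivrMr ?exprn_gt0// -[leLHS]mulr1 ler_pM ?exprn_ge0 ?exprn_ege1//.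
  by rewrite lerXn2r// ?nnegrE; lra.
have second_term : 48 * C / Num.sqrt (Lam * 6 ^+ i / 32) * s <=
    48 * C * k * (5 / 12) ^+ i.
  have -> : Lam * 6 ^+ i / 32 = L%:R * 6 ^+ i / (32 * K).
    by rewrite /Lam; field; rewrite lt0r_neq0.
  have q6 : (12 / 5) ^+ i <= Num.sqrt (6 ^+ i) :> R.
    rewrite -[leLHS]ger0_norm ?exprn_ge0 ?divr_ge0// -sqrtr_sqr ler_wsqrtr//.
    by rewrite exprAC lerXn2r// ?nnegrE; lra.
  have q60 : 0 < (12 / 5) ^+ i :> R by rewrite exprn_gt0.
  rewrite sqrtrM ?sqrtrM ?sqrtrV -/s -/k ?mulr_ge0 ?exprn_ge0//; try by rewrite ltW.
  rewrite (_ : 5 / 12 = (12 / 5)^-1); last by field.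
  rewrite exprVn.
  have -> : 48 * C / (s * Num.sqrt (6 ^+ i) / k) * s = 48 * C * k / Num.sqrt (6 ^+ i).
    by field; rewrite !lt0r_neq0// (lt_le_trans q60).
  apply: ler_wpM2l; first by rewrite !mulr_ge0 ?(ltW k0)//; lra.
  by rewrite lef_pV2 ?posrE// (lt_le_trans q60).
have Q0 : 0 <= Q.
  rewrite addr_ge0// !mulr_ge0 ?invr_ge0 ?sqrtr_ge0 ?sqr_ge0//; lra.
apply: (@le_trans _ _ (4 * (Q * s))).
  by have := ler_wpM2l Q0 s1; lra.
rewrite /Q mulrDl; lra.
Qed.

(** Borel-Cantelli over dyadic groups of runs, for each of the countably many windows
    of integer radius. *)
Lemma ae_transient_runs : almost_surely_transient a X.
Proof.
have K0 : 0 <= K.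
  have := @run_length_doubling 1 1 isT isT.
  have : 0 < (c 2 - c 1)%:R :> R by rewrite ltr0n subn_gt0 c_incr.
  nra.
pose A (n i : nat) : set T := \big[setU/set0]_(k < (4 * 2 ^ i)%N)
  run_visits n.+1%:R (4 * 2 ^ i + k)%N.
have mrun C m : measurable (run_visits C m) by exact: measurable_sign_event.
have mA n i : measurable (A n i) by apply: bigsetU_measurable.
have rare n : {ae P, forall w, exists N, forall i, (N <= i)%N -> ~ A n i w}.
  pose M : R := 32 * (32 * K) ^+ 2 + 192 * n.+1%:R * Num.sqrt (32 * K).
  have M0 : 0 <= M by rewrite addr_ge0 ?mulr_ge0 ?sqr_ge0 ?sqrtr_ge0.
  apply: (@ae_eventually_not_geometric _ (4 * M) (5 / 6)) => //.
  - by rewrite mulr_ge0.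
  - by lra.
  move=> i; apply: (@le_trans _ _
    (\sum_(k < (4 * 2 ^ i)%N) P (run_visits n.+1%:R (4 * 2 ^ i + k)%N))%E).
    exact: (@content_subadditive _ _ _ P _ (fun k => run_visits n.+1%:R (4 * 2 ^ i + k)%N)).
  apply: (@le_trans _ _ (\sum_(k < (4 * 2 ^ i)%N) (M * (5 / 12) ^+ i)%:E)%E).
    apply: lee_sum => k _; apply: prob_run_visits_le; first by rewrite ler1n.
    by have := ltn_ord k; rewrite leq_addr; lia.
  rewrite sumEFin lee_fin sumr_const card_ord -[leLHS]mulr_natl natrM natrX.
  rewrite (_ : 5 / 6 = 2 * (5 / 12)); last by field.
  rewrite (exprMn _ 2); move: ((5 / 12) ^+ i) (2 ^+ i) => x y; lra.
have := ae_sign X_sign; have := ae_foralln rare; apply: filterS2 => w fin Xw C C0 rec.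
set n := Num.truncn C.
have Cn : C <= n.+1%:R by rewrite ltW// truncnS_gt.
have [N HN] := fin n.
apply: rec; apply: (@sub_finite_set _ _ `I_(c (4 * 2 ^ N))); last exact: finite_II.
move=> t /= St; rewrite ltnNge; apply/negP => Nt.
(* The run that contains the time [t] is the last one to start no later than [t]. *)
have [m /andP[Nm /andP[mt tm]]] : exists m, (4 * 2 ^ N <= m)%N && (c m <= t < c m.+1)%N.
  have ex : exists m, (4 * 2 ^ N <= m)%N && (t < c m.+1)%N.
    exists (4 * 2 ^ N + t)%N; rewrite leq_addr /=.
    have c_ge j : (j <= c j.+1)%N.
      by elim: j => // j; move/leq_ltn_trans; apply; rewrite c_incr.
    apply: leq_trans (c_ge _); rewrite -addn1 addnC leq_add2r muln_gt0 expn_gt0//.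
  have [[|m] /andP[Nm tm] mmin] := ex_minnP ex.
    exists 0%N; rewrite Nm tm andbT (leq_trans _ Nt)//.
    by move: Nm; rewrite leqn0 muln_eq0 expn_eq0.
  exists m.+1; rewrite Nm tm andbT /=.
  move: Nm; rewrite leq_eqVlt => /orP[/eqP <-//|Nm].
  rewrite leqNgt; apply/negP => tc.
  by have := mmin m; rewrite tc -ltnS Nm => /(_ isT); rewrite ltnn.
(* The dyadic group of that run. *)
have m4 : (4 <= m)%N by rewrite (leq_trans _ Nm)// leq_pmulr// expn_gt0.
have /andP[lo hi] := trunc_log_bounds (isT : (1 < 2)%N) (leq_trans (isT : (0 < 4)%N) m4).
set l := trunc_log 2 m in lo hi.
have l2 : (2 <= l)%N by rewrite -ltnS -(ltn_exp2l _ _ (isT : (1 < 2)%N)) (leq_ltn_trans m4).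
have lE : l = (l - 2 + 2)%N by rewrite subnK.
set i := (l - 2)%N in lE; rewrite lE expnD in lo; rewrite lE expnS expnD in hi.
have Ni : (N <= i)%N.
  rewrite -ltnS -(ltn_exp2l _ _ (isT : (1 < 2)%N)) expnS; lia.
apply: (HN i Ni).
rewrite /A -(bigcup_mkord _ (fun k => run_visits n.+1%:R (4 * 2 ^ i + k)%N)).
exists (m - 4 * 2 ^ i)%N; first by rewrite /=; lia.
rewrite subnKC; last by lia.
have [walkE inE] := walk_sign_event a
  (visits_window a n.+1%:R (c m) (c m.+1 - c m)) (c m.+1) Xw.
apply: inE; apply/existsP.
have tL : (t - c m < (c m.+1 - c m).+1)%N by lia.
exists (Ordinal tL); rewrite /= subnKC// -walkE; last exact: ltnW.
exact: le_trans St Cn.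
Qed.

End Transience.

(** * The runs of the sequence of floors of powers *)

Section FloorPowRuns.
Context {R : realType}.
Implicit Types g x y : R.

Lemma powR_convex g x y t : 1 <= g -> 0 <= x -> 0 <= y -> 0 <= t <= 1 ->
  (t * x + (1 - t) * y) `^ g <= t * x `^ g + (1 - t) * y `^ g.
Proof.
move=> g1 x0 y0 /andP[t0 t1].
have := @convex_powR R g g1 (Itv01 t0 t1) x y.
by rewrite !inE /= !in_itv /= !andbT !convRE /=; apply.
Qed.

(** Convexity: [x + 1] and [y] are mirror-image convex combinations of the outer
    points [x] and [y + 1]. *)
Lemma powR_increment_le g x y : 1 <= g -> 0 <= x -> x <= y ->
  (x + 1) `^ g - x `^ g <= (y + 1) `^ g - y `^ g.
Proof.
move=> g1 x0 xy; set t := (y + 1 - x)^-1.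
have yx : 0 < y + 1 - x by lra.
have t01 : 0 <= t <= 1.
  by rewrite invr_ge0 ltW//= invf_le1//; lra.
have ht : t * (y + 1 - x) = 1 by rewrite mulVf// gt_eqF.
have H1 := @powR_convex g x (y + 1) t g1 x0 _ t01.
have H2 := @powR_convex g (y + 1) x t g1 _ x0 t01.
rewrite (_ : t * x + _ = y) in H1; last by lra.
rewrite (_ : t * (y + 1) + _ = x + 1) in H2; last by lra.
have y10 : 0 <= y + 1 by lra.
by have := H1 y10; have := H2 y10; lra.
Qed.

(** For [g = 1 / beta], the least index [k], counted from 1, with
    [m <= k ^ beta]. *)
Definition first_reach g (m : nat) : nat := `|Num.ceil (m%:R `^ g : R)|%N.

Lemma first_reach_le g m n : (first_reach g m <= n)%N = (m%:R `^ g <= n%:R :> R).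
Proof.
rewrite -[n%:R]/((Posz n)%:~R) -ceil_le_int -lez_nat gez0_abs//.
by rewrite ceil_ge0 (lt_le_trans _ (powR_ge0 _ _))// ltrN10.
Qed.

Lemma first_reach_itv g m :
  m%:R `^ g <= (first_reach g m)%:R < (m%:R `^ g + 1 : R).
Proof.
rewrite -first_reach_le leqnn /=.
case E : (first_reach g m) => [|n]; first by rewrite ltr_pwDr ?powR_ge0.
by rewrite -natr1 ltrD2r ltNge -first_reach_le E ltnn.
Qed.

Lemma powR_increment_ge1 g m : 1 <= g -> 1 <= m.+1%:R `^ g - m%:R `^ g :> R.
Proof.
move=> g1; have := powR_increment_le g1 (lexx 0) (ler0n _ m).
rewrite add0r powR1 powR0 ?subr0 -?natr1//.
by rewrite gt_eqF// (lt_le_trans ltr01).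
Qed.

Lemma first_reach_incr g m : 1 <= g -> (first_reach g m < first_reach g m.+1)%N.
Proof.
move=> g1; rewrite -(ltr_nat R).
have := powR_increment_ge1 m g1.
by have /andP[_] := first_reach_itv g m; have /andP[] := first_reach_itv g m.+1; lra.
Qed.

(** Up to rounding, the gaps are increments of the convex function [x ^ g]; these
    increase with [x], and the increment at [4 j] is at most the one over
    [4 j, 4 j + 4], which is [4 ^ g] times the increment at [j]. The factor 4 pays
    for the rounding, as all gaps and increments are at least 1. *)
Lemma first_reach_gap_le g j m : 1 <= g -> (j <= m)%N -> (m <= 4 * j)%N ->
  (first_reach g m.+1 - first_reach g m)%:R <=
  4 * 4 `^ g * (first_reach g j.+1 - first_reach g j)%:R :> R.
Proof.
move=> g1 jm mj.
have gapE k : (first_reach g k.+1 - first_reach g k)%:R =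
    (first_reach g k.+1)%:R - (first_reach g k)%:R :> R.
  by rewrite natrB// ltnW// first_reach_incr.
have gap1 : 1 <= (first_reach g j.+1 - first_reach g j)%:R :> R.
  by rewrite ler1n subn_gt0 first_reach_incr.
have Dj : m.+1%:R `^ g - m%:R `^ g <= 4 `^ g * (j.+1%:R `^ g - j%:R `^ g) :> R.
  have mj4 : m%:R <= 4 * j%:R :> R by rewrite -natrM ler_nat.
  rewrite -natr1 (le_trans (powR_increment_le g1 (ler0n _ m) mj4))//.
  rewrite mulrBr -!powRM// lerD2r ge0_ler_powR ?nnegrE ?addr_ge0 ?mulr_ge0//.
    by rewrite (le_trans ler01).
  by rewrite -natr1; lra.
have D0 := powR_increment_ge1 m g1.
have p4 : 0 < 4 `^ g :> R by rewrite powR_gt0.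
move: Dj gap1 D0 p4; rewrite !gapE.
have /andP[] := first_reach_itv g m; have /andP[] := first_reach_itv g m.+1.
have /andP[] := first_reach_itv g j; have /andP[] := first_reach_itv g j.+1.
move: (first_reach g j.+1)%:R (first_reach g j)%:R (first_reach g m.+1)%:R
  (first_reach g m)%:R (4 `^ g) => cj1 cj cm1 cm q.
move: (j.+1%:R `^ g) (j%:R `^ g) (m.+1%:R `^ g) (m%:R `^ g) => pj1 pj pm1 pm.
move=> ? ? ? ? ? ? ? ? ? ? ? q0.
have : q * (pj1 - pj) <= q * (2 * (cj1 - cj)) by apply: ler_wpM2l; [lra|lra].
lra.
Qed.

(** The predecessors translate between indices counted from 1 and from 0. *)
Lemma floor_pow_run beta j k : 0 < beta -> (0 < j)%N ->
  ((first_reach beta^-1 j).-1 <= k < (first_reach beta^-1 j.+1).-1)%N ->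
  floor_pow beta k = j%:R :> R.
Proof.
move=> b0 j0 /andP[jk kj].
have le_pow m : (m%:R <= k.+1%:R `^ beta :> R) = (first_reach beta^-1 m <= k.+1)%N.
  have powK x : 0 <= x -> (x `^ beta) `^ beta^-1 = x.
    by move=> x0; rewrite -powRrM mulfV ?gt_eqF// powRr1.
  have powKV x : 0 <= x -> (x `^ beta^-1) `^ beta = x.
    by move=> x0; rewrite -powRrM mulVf ?gt_eqF// powRr1.
  rewrite first_reach_le; apply/idP/idP => H.
    rewrite -[leRHS]powK// ge0_ler_powR ?nnegrE ?powR_ge0//.
    by rewrite invr_ge0 ltW.
  by rewrite -[leLHS]powKV// ge0_ler_powR ?nnegrE ?powR_ge0// ltW.
rewrite /floor_pow (floor_def (m := Posz j))// -[X in _ + X]/(Posz 1) -PoszD addn1.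
apply/andP; split; first by rewrite [_%:~R]/(j%:R) le_pow; lia.
by rewrite ltNge [_%:~R]/(j.+1%:R) le_pow -ltnNge; lia.
Qed.

End FloorPowRuns.

Theorem theorem7 (R : realType) (d : measure_display) (T : measurableType d)
    (P : probability T R) (X : nat -> {RV P >-> R})
    (X_indep : independent_RVs X) (X_rademacher : forall k, rademacher (X k))
    (beta : R) (beta_gt0 : 0 < beta) (beta_lt1 : beta < 1) :
  almost_surely_transient (floor_pow beta) X.
Proof.
have g1 : 1 <= beta^-1 by rewrite invf_ge1// ltW.
have reach_pos j : (0 < j)%N -> (0 < first_reach beta^-1 j)%N.
  by case: j => // j _; rewrite (leq_ltn_trans _ (first_reach_incr j g1)).
apply: (@ae_transient_runs _ _ _ _ _ X_indep X_rademacher _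
  (fun j => (first_reach beta^-1 j).-1) (4 * 4 `^ beta^-1)).
- by move=> j k; exact: floor_pow_run.
- move=> j j0; have := reach_pos j j0; have := first_reach_incr j g1; lia.
- move=> j m /andP[j0 jm] mj.
  have shift i : (0 < i)%N -> ((first_reach beta^-1 i.+1).-1 - (first_reach beta^-1 i).-1
     = first_reach beta^-1 i.+1 - first_reach beta^-1 i)%N.
    by move=> i0; have := reach_pos i i0; have := reach_pos i.+1 isT; lia.
  by rewrite !shift// ?(leq_trans j0)// first_reach_gap_le.
Qed.
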